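(* Let $G$ be a finite simple graph. Let $d=\min\{\gamma_{2,2}(\vec{G})\}$ and $D=\max\{\gamma_{2,2}(\vec{G})\}$, where $\vec{G}$ ranges over all orientations of $G$. Then for every integer $b$ with $d\le b\le D$ there exists an orientation $\vec{G}_b$ of $G$ with $\gamma_{2,2}(\vec{G}_b)=b$.
   Context: An orientation $\vec{G}$ of a graph $G$ assigns to every edge $\{u,v\}$ exactly one direction. For vertices $u,v$ of $\vec{G}$, $d(u,v)$ is the minimum length of a directed path from $u$ to $v$ ($d(u,u)=0$; $\infty$ if none exists). Given positive integers $t,r$ and $S\subseteq V(\vec{G})$, the directed reception at $w$ is $\vec{r}(w)=\sum_{v\in S,\ d(v,w)<t}(t-d(v,w))$; $S$ is a directed $(t,r)$ broadcast dominating set if $\vec{r}(w)\ge r$ for every vertex $w$, and $\gamma_{t,r}(\vec{G})$ is the minimum cardinality of such a set. *)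

(* Defs.v *)
From mathcomp Require Import all_boot.

Set Implicit Arguments.
Unset Strict Implicit.
Unset Printing Implicit Defensive.

(* A simple graph on T is a symmetric irreflexive e : rel T; a digraph is an
   arbitrary o : rel T, with o u v meaning that there is an arc from u to v. *)

Definition orientation (T : finType) (e o : rel T) : Prop :=
  (forall u v, o u v -> e u v) /\ (forall u v, e u v -> o u v (+) o v u).

Definition dipath (T : finType) (o : rel T) (u v : T) (p : seq T) : bool :=
  [&& path o u p, last u p == v & uniq (u :: p)].

Definition has_dipath (T : finType) (o : rel T) (u v : T) (n : nat) : bool :=
  [exists p : n.-tuple T, dipath o u v p].

(* None stands for an infinite distance. The search is bounded by #|T| because
   a path without repeated vertices has length less than #|T|; see dist_SomeP
   and dist_NoneP. *)
Definition dist (T : finType) (o : rel T) (u v : T) : option nat :=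
  let n := find (has_dipath o u v) (iota 0 #|T|) in
  if n < #|T| then Some n else None.

(* The subtraction is truncated, so only the v with d(v, w) < t contribute. *)
Definition reception (T : finType) (o : rel T) (t : nat) (S : {set T}) (w : T)
    : nat :=
  \sum_(v in S) (if dist o v w is Some k then t - k else 0).

Definition dominating (T : finType) (o : rel T) (t r : nat) (S : {set T})
    : bool :=
  [forall w, r <= reception o t S w].

(* When r <= t the whole vertex set is dominating, so that this is the minimum
   (gammaP); when there is no dominating set the value is the default #|T|. *)
Definition gamma (T : finType) (o : rel T) (t r : nat) : nat :=
  #|[arg min_(S < [set: T] | dominating o t r S) #|S| ]|.

Definition is_min (P : nat -> Prop) (m : nat) : Prop :=
  P m /\ forall k, P k -> m <= k.

Definition is_max (P : nat -> Prop) (m : nat) : Prop :=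
  P m /\ forall k, P k -> k <= m.

Definition orientation_value (T : finType) (e : rel T) (t r k : nat) : Prop :=
  exists2 o : rel T, orientation e o & gamma o t r = k.

Lemma has_dipathP (T : finType) (o : rel T) (u v : T) (n : nat) :
  reflect (exists2 p, dipath o u v p & size p = n) (has_dipath o u v n).
Proof.
apply: (iffP existsP) => [[p up]|[p up /eqP sp]].
  by exists (tval p); rewrite ?size_tuple.
by exists (Tuple sp).
Qed.

Lemma has_dipath_ltn (T : finType) (o : rel T) (u v : T) (n : nat) :
  has_dipath o u v n -> n < #|T|.
Proof.
case/has_dipathP=> p /and3P[_ _ up] <-.
by rewrite -[(size p).+1]/(size (u :: p)) -(card_uniqP up) max_card.
Qed.

Lemma dist_SomeP (T : finType) (o : rel T) (u v : T) (n : nat) :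
  dist o u v = Some n <-> is_min (has_dipath o u v) n.
Proof.
rewrite /dist; set a := has_dipath o u v; set s := iota 0 #|T|.
have ss : size s = #|T| by rewrite size_iota.
have min m : a m -> find a s <= m.
  move=> am; rewrite leqNgt; apply/negP=> lt_m.
  have := before_find 0 lt_m.
  by rewrite nth_iota ?add0n ?am ?(has_dipath_ltn am).
have hit : find a s < #|T| -> a (find a s).
  move=> lt_f; have := lt_f; rewrite -{1}ss -has_find => /(nth_find 0).
  by rewrite nth_iota.
split.
  by case: ifP => // lt_f [<-]; split; [exact: hit | exact: min].
case=> an minn; have lt_f := leq_ltn_trans (min _ an) (has_dipath_ltn an).
rewrite lt_f; congr Some; apply/eqP; rewrite eqn_leq (min _ an) /=.
exact: minn (hit lt_f).
Qed.

Lemma dist_NoneP (T : finType) (o : rel T) (u v : T) :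
  dist o u v = None <-> forall p, ~~ dipath o u v p.
Proof.
split=> [dN p|noP].
  apply/negP=> up; have ex : exists n, has_dipath o u v n.
    by exists (size p); apply/has_dipathP; exists p.
  have [n an minn] := ex_minnP ex.
  by have/dist_SomeP := conj an minn; rewrite dN.
case E: (dist o u v) => [n|] //.
by have [/has_dipathP[p up _] _] := (dist_SomeP o u v n).1 E; case/negP: (noP p).
Qed.

Lemma dist_refl (T : finType) (o : rel T) (u : T) : dist o u u = Some 0.
Proof.
apply/dist_SomeP; split=> //; apply/has_dipathP.
by exists [::]; rewrite /dipath //= eqxx.
Qed.

Lemma gammaP (T : finType) (o : rel T) (t r : nat) : r <= t ->
  is_min (fun k => exists2 S : {set T}, dominating o t r S & #|S| = k)
         (gamma o t r).
Proof.
move=> le_rt; have domT : dominating o t r [set: T].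
  apply/forallP=> w; rewrite /reception (bigD1 w) ?inE //= dist_refl subn0.
  exact: leq_trans le_rt (leq_addr _ _).
rewrite /gamma; case: arg_minnP => // S domS minS.
by split=> [|k [S' domS' <-]]; [exists S | exact: minS].
Qed.

Lemma orientation_exists (T : finType) (e : rel T) :
  symmetric e -> irreflexive e -> exists o : rel T, orientation e o.
Proof.
move=> sym_e irr_e; exists (fun u v => e u v && (enum_rank u < enum_rank v)).
split=> u v; first by case/andP.
move=> euv; rewrite [e v u]sym_e euv /=.
case: ltngtP => // /val_inj/enum_rank_inj uv.
by rewrite uv irr_e in euv.
Qed.

(* Main.v *)
(** Reversing one arc [x -> y] changes gamma_{2,2} by at most one, because
    [y |: S] still dominates when [S] did: [y] is the only vertex losing an
    in-neighbour. Any two orientations of a graph are joined by such reversals,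
    so no value between the minimum and the maximum is skipped. *)
Require Import Defs.
From mathcomp Require Import all_boot.

Set Implicit Arguments.
Unset Strict Implicit.
Unset Printing Implicit Defensive.

Lemma has_dipath0 (T : finType) (o : rel T) (u v : T) :
  has_dipath o u v 0 = (u == v).
Proof.
apply/has_dipathP/eqP => [[p /and3P[_ /eqP luv _] /size0nil p0]|->].
  by rewrite -luv p0.
by exists [::]; rewrite // /dipath /= eqxx.
Qed.

Lemma has_dipath1 (T : finType) (o : rel T) (u v : T) :
  has_dipath o u v 1 = (u != v) && o u v.
Proof.
apply/has_dipathP/andP => [[[|x [|//]] // /and3P[]]|[neq_uv ouv]].
  by rewrite /= andbT => oux /eqP <-; rewrite !inE andbT.
by exists [:: v]; rewrite // /dipath /= ouv eqxx inE neq_uv.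
Qed.

(** With [t = 2] a vertex gives 2 at distance 0, 1 at distance 1 and, by truncation, 0 further away.
    The case [v == w] is kept apart because [o] may have loops here. *)
Lemma reception2E (T : finType) (o : rel T) (S : {set T}) (w : T) :
  reception o 2 S w = \sum_(v in S) (if v == w then 2 else o v w : nat).
Proof.
apply: eq_bigr => v _; case: eqVneq => [->|neq_vw]; first by rewrite dist_refl.
have path1 : has_dipath o v w 1 = o v w by rewrite has_dipath1 neq_vw.
case Evw: (dist o v w) => [n|]; last first.
  move/dist_NoneP: Evw => no_path; case ovw: (o v w) => //.
  have /has_dipathP[p vwp _] : has_dipath o v w 1 by rewrite path1.
  by have := no_path p; rewrite vwp.
have /dist_SomeP[path_n min_n] := Evw.
case: n path_n min_n {Evw} => [|[|n]] path_n min_n.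
- by rewrite has_dipath0 (negPf neq_vw) in path_n.
- by rewrite -path1 path_n.
by case ovw: (o v w) => //; move: (min_n 1); rewrite path1 ovw => /(_ isT).
Qed.

(** Enlarge a minimum dominating set of [o] by [A]: a vertex of [A] receives 2 from itself, and any
    other vertex keeps all its in-neighbours. *)
Lemma gamma2_le_add_card (T : finType) (o o' : rel T) (A : {set T}) (r : nat) :
  r <= 2 -> (forall u v, v \notin A -> o u v -> o' u v) ->
  gamma o' 2 r <= gamma o 2 r + #|A|.
Proof.
move=> le_r2 sub_oo'.
have [[S domS <-] _] := gammaP o le_r2; have [_ min_o'] := gammaP o' le_r2.
apply: leq_trans (leq_card_setU S A); apply: min_o'; exists (S :|: A) => //.
apply/forallP=> w; rewrite reception2E.
have [Aw|notAw] := boolP (w \in A).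
  rewrite (bigD1 w) ?inE ?Aw ?orbT //= eqxx.
  exact: leq_trans le_r2 (leq_addr _ _).
apply: leq_trans (forallP domS w) _; rewrite reception2E.
rewrite [leqRHS](big_setID S) /= setUK.
apply: leq_trans (leq_addr _ _); apply: leq_sum => v _.
case: ifP => // _; have := sub_oo' v w notAw.
by case: (o v w) => // /(_ isT) ->.
Qed.

Definition reverse_arc (T : finType) (o : rel T) (x y : T) : rel T :=
  fun u v => if ((u, v) == (x, y)) || ((u, v) == (y, x)) then o v u else o u v.

Lemma orientation_reverse_arc (T : finType) (e o : rel T) (x y : T) :
  symmetric e -> orientation e o -> orientation e (reverse_arc o x y).
Proof.
move=> e_sym [sub_oe tot_o]; rewrite /reverse_arc; split=> u v.
  by case: ifP => _ /sub_oe //; rewrite e_sym.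
(* The test is invariant under exchanging [u] and [v], so both terms of the exclusive or are swapped
   together or not at all. *)
have -> : ((v, u) == (x, y)) || ((v, u) == (y, x)) =
          ((u, v) == (x, y)) || ((u, v) == (y, x)).
  by rewrite !xpair_eqE orbC; congr orb; rewrite andbC.
by case: ifP => _ /tot_o //; rewrite addbC.
Qed.

Lemma gamma2_reverse_arc (T : finType) (o : rel T) (x y : T) (r : nat) :
  o x y -> r <= 2 -> gamma (reverse_arc o x y) 2 r <= (gamma o 2 r).+1.
Proof.
move=> oxy le_r2; have -> : (gamma o 2 r).+1 = gamma o 2 r + #|[set y]|.
  by rewrite cards1 addn1.
apply: gamma2_le_add_card => // u v; rewrite inE /reverse_arc => neq_vy ouv.
(* At [(y, x)] the reversed relation reads [o x y], which holds; at [(x, y)] the head would be [y],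
   which is excluded. *)
case: ifP => // /orP[] /eqP[Eu Ev]; last by rewrite Eu Ev.
by rewrite Ev eqxx in neq_vy.
Qed.

(** For two orientations of one graph, this has one element per edge on which they disagree. *)
Definition arcs_diff (T : finType) (o o' : rel T) : {set T * T} :=
  [set p | o p.1 p.2 && ~~ o' p.1 p.2].

(** The pair [(x, y)] leaves the difference, and the new arc from [y] to [x] does not enter it
    because [o'] has that arc too. *)
Lemma arcs_diff_reverse_arc (T : finType) (e o o' : rel T) (x y : T) :
  orientation e o -> orientation e o' -> (x, y) \in arcs_diff o o' ->
  arcs_diff (reverse_arc o x y) o' \proper arcs_diff o o'.
Proof.
move=> [sub_oe tot_o] [_ tot_o'] diff_xy.
have := diff_xy; rewrite inE /= => /andP[oxy not_o'xy].
have exy := sub_oe _ _ oxy.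
have not_oyx : ~~ o y x by move: (tot_o _ _ exy); rewrite oxy.
have o'yx : o' y x by move: (tot_o' _ _ exy); rewrite (negPf not_o'xy).
apply/properP; split.
  apply/subsetP=> -[u v]; rewrite !inE /reverse_arc /=.
  case: ifP => // /orP[] /eqP[-> ->]; first by rewrite (negPf not_oyx).
  by rewrite o'yx andbF.
by exists (x, y); rewrite // inE /reverse_arc /= eqxx (negPf not_oyx).
Qed.

(** Induction on the number of disagreements, with [o'] fixed and [o] moving towards it: a value
    below [b] is still at most [b] after one reversal. *)
Lemma gamma2_interpolation (T : finType) (e : rel T) (r b : nat)
    (o o' : rel T) :
  symmetric e -> r <= 2 ->
  orientation e o -> orientation e o' ->
  gamma o 2 r <= b <= gamma o' 2 r ->
  exists2 ob : rel T, orientation e ob & gamma ob 2 r = b.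
Proof.
move=> e_sym le_r2 or_o or_o'.
have [n] := ubnP #|arcs_diff o o'|; elim: n o or_o => // n IHn o or_o.
rewrite ltnS => le_n /andP[]; rewrite leq_eqVlt => /predU1P[<- _|lt_b le_b].
  by exists o.
have [diff0|[[x y] diff_xy]] := set_0Vmem (arcs_diff o o').
  (* Without disagreement every arc of [o] is an arc of [o'], so [A] empty gives
     [gamma o' 2 r <= gamma o 2 r < b], a contradiction. *)
  have : gamma o' 2 r <= gamma o 2 r + #|@set0 T|.
    apply: gamma2_le_add_card => // u v _ ouv; apply: contraT => not_o'uv.
    by have := in_set0 (u, v); rewrite -diff0 inE /= ouv not_o'uv.
  rewrite cards0 addn0 => le_o'o.
  by have := leq_ltn_trans (leq_trans le_b le_o'o) lt_b; rewrite ltnn.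
have oxy : o x y by move: diff_xy; rewrite inE => /andP[].
apply: (IHn (reverse_arc o x y)); first exact: orientation_reverse_arc.
  exact: leq_trans (proper_card (arcs_diff_reverse_arc or_o or_o' diff_xy)) le_n.
by rewrite le_b andbT (leq_trans (gamma2_reverse_arc oxy le_r2)).
Qed.

Theorem mainTheorem3 (T : finType) (e : rel T)
    (e_sym : symmetric e) (e_irr : irreflexive e) (d D : nat)
    (d_min : is_min (orientation_value e 2 2) d)
    (D_max : is_max (orientation_value e 2 2) D) :
  forall b : nat, d <= b <= D ->
    exists2 ob : rel T, orientation e ob & gamma ob 2 2 = b.
Proof.
move=> b; have [[o or_o <-] _] := d_min; have [[o' or_o' <-] _] := D_max.
exact: gamma2_interpolation.
Qed.
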